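(* Let $a<b$ be real numbers, let $n\ge 0$ be an integer, and let $X=\mathcal{P}_n$. Then there exist $m\le n+1$ points $a\le t_1<t_2<\cdots<t_m\le b$ and $m$ scalars $w_i>0$ such that $x^*=\sum_{i=1}^m w_i x^*_{t_i}$. More explicitly, $$\int_a^b x(t)\,dt=\sum_{i=1}^m w_i x(t_i)\quad\text{for all } x\in X.$$
   Context: $\mathcal{P}_n$ is the space of real polynomials of degree at most $n$, regarded as a subspace of $C[a,b]$ with norm $\|x\|=\max\{|x(t)|\mid a\le t\le b\}$. The linear functionals $x^*$ and $x_t^*$ ($t\in[a,b]$) on $X=\mathcal{P}_n$ are defined by $x^*(x):=\int_a^b x(t)\,dt$ and $x_t^*(x):=x(t)$ for all $x\in X$. *)

(* Defs.v *)
From HB Require Import structures.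
From mathcomp Require Import all_boot all_order all_algebra.
From mathcomp Require Import all_classical all_reals all_analysis.
Set Implicit Arguments.
Unset Strict Implicit.
Unset Printing Implicit Defensive.
Import Order.TTheory GRing.Theory Num.Theory.
Import numFieldNormedType.Exports.
Local Open Scope classical_set_scope.
Local Open Scope ring_scope.

(* [{poly_k R}] bounds the size, which is the degree plus one: the polynomials
   of degree at most [n] form [{poly_n.+1 R}]. *)
Definition integral_on (R : realType) (a b : R) (n : nat)
    (x : {poly_n.+1 R}) : R^o :=
  \int[lebesgue_measure]_(t in `[a, b]) (x : {poly R}).[t].

Definition eval_at (R : realType) (t : R) (n : nat) (x : {poly_n.+1 R}) : R^o :=
  (x : {poly R}).[t].

Lemma integrable_horner (R : realType) (a b : R) (p : {poly R}) :
  lebesgue_measure.-integrable `[a, b] (EFin \o horner p).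
Proof.
apply: continuous_compact_integrable; first exact: segment_compact.
by apply: continuous_subspaceT; exact: continuous_horner.
Qed.

Lemma integral_on_is_linear (R : realType) (a b : R) (n : nat) :
  linear (@integral_on R a b n).
Proof.
move=> c x y; rewrite /integral_on.
under eq_Rintegral do rewrite linearP /= hornerD hornerZ.
rewrite RintegralD //; last exact: integrable_horner.
  by rewrite RintegralZl //; exact: integrable_horner.
have -> : EFin \o (fun t => c * (x : {poly R}).[t])
        = EFin \o horner (c *: (x : {poly R})).
  by apply/funext => t /=; rewrite hornerZ.
exact: integrable_horner.
Qed.

HB.instance Definition _ (R : realType) (a b : R) (n : nat) :=
  GRing.isLinear.Build R {poly_n.+1 R} R^o _ (@integral_on R a b n)
    (@integral_on_is_linear R a b n).

Lemma eval_at_is_linear (R : realType) (t : R) (n : nat) :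
  linear (@eval_at R t n).
Proof. by move=> c x y; rewrite /eval_at linearP /= hornerD hornerZ. Qed.

HB.instance Definition _ (R : realType) (t : R) (n : nat) :=
  GRing.isLinear.Build R {poly_n.+1 R} R^o _ (@eval_at R t n)
    (@eval_at_is_linear R t n).

(* The functionals $x^*$ and $x_t^*$. [linfun] carries the given function only
   when that function is linear, as [integral_functionalE] and
   [eval_functionalE] confirm. *)
Definition integral_functional (R : realType) (a b : R) (n : nat) :
    'Hom({poly_n.+1 R}, R^o) :=
  linfun (@integral_on R a b n).

Definition eval_functional (R : realType) (n : nat) (t : R) :
    'Hom({poly_n.+1 R}, R^o) :=
  linfun (@eval_at R t n).

Lemma integral_functionalE (R : realType) (a b : R) (n : nat)
    (x : {poly_n.+1 R}) :
  integral_functional a b n x =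
  \int[lebesgue_measure]_(t in `[a, b]) (x : {poly R}).[t].
Proof. by rewrite /integral_functional lfunE. Qed.

Lemma eval_functionalE (R : realType) (n : nat) (t : R)
    (x : {poly_n.+1 R}) :
  eval_functional n t x = (x : {poly R}).[t].
Proof. by rewrite /eval_functional lfunE. Qed.

(* Main.v *)
Require Import Defs.
From HB Require Import structures.
From mathcomp Require Import polyrcf.
From mathcomp Require Import all_boot all_order all_algebra.
From mathcomp Require Import all_classical all_reals all_analysis.
Set Implicit Arguments.
Unset Strict Implicit.
Unset Printing Implicit Defensive.
Import Order.TTheory GRing.Theory Num.Theory.
Import numFieldNormedType.Exports.
Local Open Scope classical_set_scope.
Local Open Scope ring_scope.

(** The formula obtained is Gauss quadrature with [n + 1] nodes, which is exact
    for degrees up to [2 n + 1], hence a fortiori up to [n].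

    The argument only uses that the integral is a linear form [L] on
    polynomials with [L g > 0] whenever [g] is nonzero and nonnegative on
    [[a, b]].  Put [N = n + 1].

    - The [N] conditions [L (p * 'X^j) = 0], [j < N], are linear in the [N + 1]
      coefficients of a polynomial [p] of degree at most [N], so some nonzero
      [p] satisfies them all ([exists_orthogonal_poly]).

    - Let [s] collect the roots of odd multiplicity of [p] in [[a, b]], and let
      [q] be the product of the ['X - y] for [y] in [s].  Then [p * q] has
      constant sign on [[a, b]] ([sign_fixing_roots]), so [L (p * q)] is
      nonzero; by orthogonality [q] has degree at least [N].  Hence [p] has [N]
      distinct roots in [[a, b]] and is a multiple of [q].  Any [f] of degree
      below [2 N] that vanishes on [s] is then [p] times a polynomial of degree
      below [N], and [L f = 0] ([exists_gauss_nodes]).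

    - With [l_x] the Lagrange polynomial that is 1 at the node [x] and 0 at the
      others, [f - \sum_x f(x) l_x ^ 2] vanishes at every node, so
      [L f = \sum_x L (l_x ^ 2) f(x)].  Using the squares of the Lagrange
      polynomials makes the weights [L (l_x ^ 2)] visibly positive
      ([gauss_quadrature]). *)

(** * Roots at which a polynomial changes sign *)

Lemma horner_ge0_of_noroot (R : rcfType) (a b : R) (p : {poly R}) :
  0 <= p.[a] -> (forall x, a <= x <= b -> ~~ root p x) ->
  forall x, a <= x <= b -> 0 <= p.[x].
Proof.
move=> pa0 noroot x /andP[ax xb].
case: (lerP 0 p.[x]) => // px0.
have [|y /andP[ay yx]] := @poly_ivt R (- p) a x ax.
  by rewrite !hornerN oppr_le0 pa0 oppr_ge0 ltW.
by rewrite rootN (negPf (noroot y _)) // ay (le_trans yx).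
Qed.

(** The sequence [s] is made of the roots of odd multiplicity of [p] in
    [[a, b]].  It is built by dividing out one root at a time: each division by
    ['X - r] toggles the membership of [r] in [s], which changes the product
    [p * \prod_(y <- s) ('X - y)] at most by a square factor. *)
Lemma sign_fixing_roots (R : rcfType) (a b : R) (p : {poly R}) :
  p != 0 ->
  exists s : seq R, [/\ uniq s, {in s, forall x, a <= x <= b}, all (root p) s &
    exists e : bool, forall x, a <= x <= b ->
      0 <= (-1) ^+ e * (p * \prod_(y <- s) ('X - y%:P)).[x]].
Proof.
have [k] := ubnP (size p); elim: k p => // k IHk p szp p0.
have [[r rab pr]|noroot] :=
  pselect (exists2 r, a <= r <= b & root p r); last first.
  have nr x : a <= x <= b -> ~~ root p x.
    by move=> xab; apply/negP => px; apply: noroot; exists x.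
  exists [::]; split => //; exists (p.[a] < 0) => x xab.
  rewrite big_nil mulr1; case: (ltP p.[a] 0) => pa0.
    rewrite expr1 mulN1r -hornerN; apply: horner_ge0_of_noroot xab.
      by rewrite hornerN oppr_ge0 ltW.
    by move=> y; rewrite rootN; exact: nr.
  by rewrite mul1r; exact: horner_ge0_of_noroot nr _ xab.
have [q pE] := factor_theorem p r pr.
have q0 : q != 0 by apply: contraNneq p0 => q0; rewrite pE q0 mul0r.
have szq : (size q < k)%N.
  by move: szp; rewrite pE size_Mmonic ?monicXsubC // size_XsubC addn2.
have [s [us sab sq [e esgn]]] := IHk q szq q0.
have rootqp : subpred (root q) (root p) by move=> x; rewrite pE rootM => ->.
(* As [s] was built for [q = p / ('X - r)], the root [r] has to be toggled. *)
have [rs|rs] := boolP (r \in s).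
  exists (rem r s); split.
  - exact: rem_uniq.
  - by move=> x /mem_rem; exact: sab.
  - by apply/allP => x /mem_rem xs; apply: rootqp; exact: (allP sq).
  - exists e => x xab; have := esgn x xab.
    by rewrite pE (big_rem r rs) /= mulrA.
exists (r :: s); split.
- by rewrite /= rs.
- by move=> x; rewrite inE => /predU1P[->|] //; exact: sab.
- by rewrite /= pr; apply: sub_all sq.
- exists e => x xab; rewrite big_cons pE.
  rewrite -[X in X.[x]]mulrA mulrCA [q * _]mulrCA [X in X.[x]]mulrA -expr2.
  rewrite hornerM mulrCA mulr_ge0 ?esgn //.
  by rewrite horner_exp sqr_ge0.
Qed.

(** * Gauss quadrature for a positive linear form *)

(** A dimension count: the [N + 1] coefficients of [p] are subject to [N]
    homogeneous linear conditions.  The degree of [p] may come out smaller than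
    [N]; it is the positivity of [L] that will exclude this. *)
Lemma exists_orthogonal_poly (R : fieldType) (L : {scalar {poly R}}) (N : nat) :
  exists p : {poly R}, [/\ p != 0, (size p <= N.+1)%N &
    forall q : {poly R}, (size q <= N)%N -> L (p * q) = 0].
Proof.
pose A : 'M[R]_(N.+1, N) := \matrix_(i, j) L ('X^i * 'X^j).
have kA0 : kermx A != 0.
  rewrite -mxrank_eq0 mxrank_ker -lt0n subn_gt0 ltnS; exact: rank_leq_col.
have /rowV0Pn[u /sub_kermxP uA u0] := kA0.
exists (rVpoly u); split.
- by apply: contraNneq u0 => up0; rewrite -[u]rVpolyK up0 linear0.
- exact: size_poly.
- move=> q szq.
  have LX (j : 'I_N) : L (rVpoly u * 'X^j) = 0.
    have := congr1 (fun M : 'rV_N => M 0 j) uA; rewrite !mxE => <-.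
    rewrite /rVpoly poly_def mulr_suml linear_sum; apply: eq_bigr => i _.
    by rewrite mxE -scalerAl scalarZ valK.
  rewrite -(poly_rV_K szq) [rVpoly (poly_rV q)]/rVpoly poly_def mulr_sumr.
  rewrite linear_sum big1 // => j _.
  by rewrite -scalerAr scalarZ LX mulr0.
Qed.

Definition pos_on (R : numDomainType) (L : {poly R} -> R) (a b : R) : Prop :=
  forall g : {poly R},
    g != 0 -> (forall x, a <= x <= b -> 0 <= g.[x]) -> 0 < L g.

(** The nodes are the roots of the orthogonal polynomial [p]; positivity forces
    it to have [N] of them in [[a, b]], since otherwise the product that makes
    its sign constant would be of degree below [N] and thus orthogonal to it. *)
Lemma exists_gauss_nodes (R : rcfType) (L : {scalar {poly R}}) (a b : R)
    (N : nat) :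
  pos_on L a b ->
  exists s : seq R, [/\ size s = N, uniq s, {in s, forall x, a <= x <= b} &
    forall f : {poly R}, (size f <= N.*2)%N -> all (root f) s -> L f = 0].
Proof.
move=> Lpos.
have [p [p0 szp orth]] := exists_orthogonal_poly L N.
have [s [us sab sp [e esgn]]] := sign_fixing_roots a b p0.
have m0 (t : seq R) : \prod_(y <- t) ('X - y%:P) != 0 :> {poly R}.
  by rewrite -size_poly_eq0 size_prod_XsubC.
have les : (size s <= N)%N.
  by rewrite -ltnS; apply: leq_trans szp; exact: max_poly_roots.
have ges : (N <= size s)%N.
  rewrite leqNgt; apply/negP => lts.
  (* Then the product over [s] is of degree below [N], hence orthogonal to [p]. *)
  have := Lpos ((-1) ^+ e *: (p * \prod_(y <- s) ('X - y%:P))).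
  rewrite scalarZ orth ?size_prod_XsubC // mulr0 ltxx => H.
  suff: false by []; apply: H.
    by rewrite scaler_eq0 signr_eq0 /= mulf_neq0.
  by move=> x xab; rewrite hornerZ; exact: esgn.
have szs : size s = N by apply/eqP; rewrite eqn_leq les.
exists s; split => // f szf rf.
have urs : uniq_roots s by rewrite uniq_rootsE.
have szpE : size p = (size s).+1.
  by apply/eqP; rewrite eqn_leq szs szp -szs; exact: max_poly_roots.
have pE := all_roots_prod_XsubC szpE sp urs.
have [q fE] := uniq_roots_prod_XsubC rf urs.
have fpq : f = (lead_coef p)^-1 *: (p * q).
  rewrite [in p * q]pE -scalerAl scalerA mulVf ?lead_coef_eq0 // scale1r.
  by rewrite fE mulrC.
rewrite fpq scalarZ orth ?mulr0 //.
have [->|q0] := eqVneq q 0; first by rewrite size_poly0.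
move: szf; rewrite fE size_mul // size_prod_XsubC szs addnS /= -addnn.
by rewrite leq_add2r.
Qed.

Lemma lagrange_poly (R : fieldType) (s : seq R) (x : R) : x \in s -> uniq s ->
  exists l : {poly R}, [/\ (size l <= size s)%N, l.[x] = 1 &
    {in s, forall y, y != x -> l.[y] = 0}].
Proof.
move=> xs us; pose m := \prod_(y <- rem x s) ('X - y%:P) : {poly R}.
have mx0 : m.[x] != 0.
  by rewrite -rootE root_prod_XsubC mem_rem_uniqF.
exists (m.[x]^-1 *: m); split.
- rewrite (leq_trans (size_scale_leq _ _)) // size_prod_XsubC size_rem //.
  by rewrite prednK //; case: (s) xs.
- by rewrite hornerZ mulVf.
- move=> y ys yx; rewrite hornerZ.
  have /rootP -> : root m y by rewrite root_prod_XsubC mem_rem_uniq // !inE yx.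
  by rewrite mulr0.
Qed.

(** Exactness up to degree [2 N - 1] leaves room for the squares of the Lagrange
    polynomials of the nodes, of degree at most [2 N - 2], and positivity
    applies to squares. *)
Lemma gauss_quadrature (R : rcfType) (L : {scalar {poly R}}) (a b : R)
    (N : nat) :
  pos_on L a b ->
  exists (s : seq R) (w : R -> R),
    [/\ size s = N, sorted <%R s, {in s, forall x, a <= x <= b},
        {in s, forall x, 0 < w x} &
    forall f : {poly R}, (size f <= N.*2)%N ->
      L f = \sum_(x <- s) w x * f.[x]].
Proof.
move=> Lpos.
have [s0 [szs0 us0 s0ab exact0]] := exists_gauss_nodes N Lpos.
pose s := sort <=%R s0.
have mems : s =i s0 by move=> x; rewrite mem_sort.
have szs : size s = N by rewrite size_sort.
have us : uniq s by rewrite sort_uniq.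
have /choice[l lP] : forall x, exists l : {poly R}, x \in s ->
    [/\ (size l <= N)%N, l.[x] = 1 & {in s, forall y, y != x -> l.[y] = 0}].
  move=> x; have [xs|_] := boolP (x \in s); last by exists 0.
  by have [l lP] := lagrange_poly xs us; exists l => _; rewrite -szs.
exists s, (fun x => L (l x ^+ 2)); split => //.
- by rewrite sort_lt_sorted.
- by move=> x; rewrite mems; exact: s0ab.
- move=> x xs; have [_ lx _] := lP x xs; apply: Lpos.
    rewrite expf_neq0 //; apply: contra_eq_neq lx => ->.
    by rewrite horner0 eq_sym oner_neq0.
  by move=> y _; rewrite horner_exp sqr_ge0.
- move=> f szf; pose h := \sum_(x <- s) f.[x] *: l x ^+ 2.
  have : L (f - h) = 0.
    apply: exact0.
      rewrite (leq_trans (size_polyD _ _)) // geq_max szf size_polyN.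
      rewrite /h big_seq.
      apply: (big_ind (fun g : {poly R} => size g <= N.*2)%N).
      - by rewrite size_poly0.
      - move=> g1 g2 H1 H2; apply: leq_trans (size_polyD _ _) _.
        by rewrite geq_max H1.
      - move=> x xs; have [szl _ _] := lP x xs.
        rewrite (leq_trans (size_scale_leq _ _)) // expr2.
        rewrite (leq_trans (size_polyMleq _ _)) // -addnn.
        by rewrite (leq_trans (leq_pred _)) // leq_add.
    apply/allP => y; rewrite -mems => ys; apply/rootP.
    rewrite hornerD hornerN /h horner_sum (bigD1_seq y) //= big_seq_cond big1.
      have [_ ly _] := lP y ys.
      by rewrite hornerZ horner_exp ly expr1n mulr1 addr0 subrr.
    move=> x /andP[xs xy]; have [_ _ l0] := lP x xs.
    by rewrite hornerZ horner_exp l0 1?eq_sym // expr0n mulr0.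
  rewrite linearB => /eqP; rewrite subr_eq0 => /eqP ->.
  by rewrite linear_sum; apply: eq_bigr => x _; rewrite scalarZ mulrC.
Qed.

(** * Strict positivity of the integral *)

Definition poly_integral (R : realType) (a b : R) (p : {poly R}) : R :=
  \int[lebesgue_measure]_(t in `[a, b]) p.[t].

Lemma poly_integral_is_scalar (R : realType) (a b : R) :
  scalar (poly_integral a b).
Proof.
move=> c p q; rewrite /poly_integral.
under eq_Rintegral do rewrite hornerD hornerZ.
rewrite RintegralD //; last exact: integrable_horner.
  by rewrite RintegralZl //; exact: integrable_horner.
have -> : EFin \o (fun t => c * p.[t]) = EFin \o horner (c *: p).
  by apply/funext => t /=; rewrite hornerZ.
exact: integrable_horner.
Qed.

HB.instance Definition _ (R : realType) (a b : R) :=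
  GRing.isLinear.Build R {poly R} R _ (poly_integral a b)
    (@poly_integral_is_scalar R a b).

Lemma lebesgue_measure_roots (R : realType) (p : {poly R}) :
  lebesgue_measure [set` rootsR p] = 0%E :> \bar R.
Proof. exact/countable_lebesgue_measure0/finite_set_countable/finite_seq. Qed.

(** If the integral of [g >= 0] were zero, [g] would vanish almost everywhere on
    [[a, b]], and this interval would be covered by a null set together with
    the finitely many roots of [g]. *)
Lemma poly_integral_gt0 (R : realType) (a b : R) :
  a < b -> pos_on (poly_integral a b) a b.
Proof.
move=> ab g g0 gge0.
rewrite lt0r Rintegral_ge0; last by move=> x /=; rewrite in_itv /=; exact: gge0.
rewrite andbT; apply/negP => /eqP Ig0.
have intg := integrable_horner a b g.
(* The integral is taken for the sigma-algebra generated by the half-open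
   intervals, and measurability has to be stated in that structure. *)
pose T := g_sigma_algebraType (R.-ocitv.-measurable).
have mD : measurable (`[a, b] : set T) by exact: measurable_itv.
have Ifin := integrable_fin_num mD intg.
have I0 :
    (\int[lebesgue_measure]_(x in `[a, b]) `|(EFin \o horner g) x| = 0)%E.
  transitivity (\int[lebesgue_measure]_(x in `[a, b]) (EFin \o horner g) x)%E.
    apply: eq_integral => x; rewrite inE /= in_itv /= => xab.
    by rewrite ger0_norm // gge0.
  by rewrite -(fineK Ifin); congr EFin.
have [A [mA A0 subA]] := (ae_eq_integral_abs _ mD (measurable_int _ intg)).1 I0.
have : lebesgue_measure (`[a, b] : set R) = 0.
  apply/eqP; rewrite eq_le measure_ge0 andbT.
  have mZ : measurable ([set` rootsR g] : set T).
    apply: countable_measurable => [t|]; first exact: measurable_set1.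
    exact/finite_set_countable/finite_seq.
  rewrite -[0%E]adde0 -[X in (_ <= X + _)%E]A0.
  rewrite -[X in (_ <= _ + X)%E](lebesgue_measure_roots g).
  apply: le_trans (measureU2 _ mA mZ).
  apply: le_measure; rewrite ?inE //; first exact: measurableU.
  move=> x /= xab; have [rx|nrx] := boolP (root g x).
    by right; rewrite /= -(roots_on_rootsR g0).
  left; apply: subA => /= H; move/negP: nrx; apply.
  by case: (H xab) => /eqP.
rewrite lebesgue_measure_itv /= lte_fin ab => /eqP.
by rewrite -EFinB eqe subr_eq0 gt_eqF.
Qed.

(** * The quadrature formula *)

Theorem theorem3p1 (R : realType) (a b : R) (n : nat) (hab : a < b) :
  exists (m : nat) (t w : 'I_m -> R),
    (m <= n + 1)%N /\
    (forall i, a <= t i <= b) /\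
    (forall i j : 'I_m, (i < j)%N -> t i < t j) /\
    (forall i, 0 < w i) /\
    integral_functional a b n =
      \sum_(i < m) w i *: eval_functional n (t i) /\
    (forall x : {poly_n.+1 R},
      \int[lebesgue_measure]_(s in `[a, b]) (x : {poly R}).[s] =
      \sum_(i < m) w i * (x : {poly R}).[t i]).

Proof.
have [s [w [szs ss sab wpos quad]]] :=
  gauss_quadrature n.+1 (poly_integral_gt0 hab).
have sE (i : 'I_n.+1) : nth 0 s i \in s by rewrite mem_nth // szs.
have int_sum (x : {poly_n.+1 R}) :
    \int[lebesgue_measure]_(u in `[a, b]) (x : {poly R}).[u] =
    \sum_(i < n.+1) w (nth 0 s i) * (x : {poly R}).[nth 0 s i].
  rewrite -[LHS]/(poly_integral a b x) quad.
    by rewrite (big_nth 0) szs big_mkord.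
  by rewrite (leq_trans (size_npoly x)) // -addnn leq_addr.
exists n.+1, (fun i => nth 0 s i), (fun i => w (nth 0 s i)).
split; first by rewrite addn1.
split; first by move=> i; exact: sab.
split; first by move=> i j ij; rewrite (lt_sorted_ltn_nth 0 ss) // inE szs.
split; first by move=> i; exact: wpos.
split=> //; apply/lfunP => x.
rewrite integral_functionalE int_sum sum_lfunE; apply: eq_bigr => i _.
by rewrite scale_lfunE eval_functionalE.
Qed.
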